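(* Let $\phi\in H^1_\#(\Gamma_Y)^2$ be an arbitrary solution of $$\int_{\Gamma_Y}\partial_\Gamma\phi(y)\,\partial_\Gamma\psi(y)\,ds(y)=-\int_{\Gamma_Y}\mathbf t(y)\,\partial_\Gamma\psi(y)\,ds(y)\qquad\forall\psi\in H^1_\#(\Gamma_Y).$$ Then the $2\times 2$ matrix $$\mathbf A_{\rm hom}=\frac1{|\Gamma_Y|}\int_{\Gamma_Y}\big(\mathbf t(y)+\partial_\Gamma\phi(y)\big)\big(\mathbf t(y)+\partial_\Gamma\phi(y)\big)^T\,ds(y)$$ is symmetric and positive definite.
   Context: Let $e_1=(1,0)$, $e_2=(0,1)$. The unit mesh $\Gamma_Y\subset[0,1]^2$ is a one-dimensional set described by a connected oriented (finite) graph with vertex set $\mathcal V$ and edge set $\mathcal E$; each edge admits a bijective $W^{1,\infty}$ arc length parametrization $\gamma$ from an open interval, directed according to the orientation; $\mathbf t(y)=\gamma'(\gamma^{-1}(y))$ is the unit tangent. It is assumed that there are $y_1,y_2\in\Gamma_Y$ with $y_1+e_1,y_2+e_2\in\Gamma_Y$. The periodic graph $\Gamma_{Y,\#}$ is obtained from $\Gamma_Y$ by identifying opposite points, i.e. $y$ with $y+e_i$ whenever both lie in $\Gamma_Y\cap\partial[0,1]^2$ (such points are vertices), and by identifying all corner points of $[0,1]^2$ that belong to $\Gamma_Y$. On an oriented edge with arc length parametrization $\gamma$, $\partial_\Gamma u(x)=\frac{d}{ds}(u\circ\gamma)(s)$ with $s=\gamma^{-1}(x)$ (componentwise for vector functions).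 Integrals over graphs are sums over edges of curve integrals of the first kind; $|\Gamma_Y|=\int_{\Gamma_Y}ds$. For a graph $\mathcal G$, $H^1(\mathcal G)=\{u\in L^2(\mathcal G):\partial_\Gamma u\in L^2(\mathcal G),\ u\text{ continuous on }\mathcal G\}$; $H^1_\#(\Gamma_Y)=H^1(\Gamma_{Y,\#})$, so its elements take equal values at identified points. *)

(* Defs.v *)
From HB Require Import structures.
From mathcomp Require Import all_boot all_order all_algebra.
From mathcomp Require Import all_classical all_reals all_analysis.
Set Implicit Arguments.
Unset Strict Implicit.
Unset Printing Implicit Defensive.
Import Order.TTheory GRing.Theory Num.Theory.
Import numFieldNormedType.Exports.
Local Open Scope classical_set_scope.
Local Open Scope ring_scope.

(** * Sobolev functions on a bounded open interval *)

Section Interval.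
Variable R : realType.
Implicit Types (a b : R) (u g p : R -> R).
Let mu := @lebesgue_measure R.

(* C^1 functions on the line with compact support in ]a, b[. *)
Definition test_function a b p : Prop :=
  [/\ forall x, derivable p x 1, continuous (derive1 p) &
      exists c d, [/\ a < c, d < b & forall x, x \notin `[c, d] -> p x = 0]].

Definition is_weak_deriv a b u g : Prop :=
  [/\ locally_integrable `]a, b[ u, locally_integrable `]a, b[ g &
      forall p, test_function a b p ->
        \int[mu]_(s in `]a, b[) (u s * derive1 p s) =
        - \int[mu]_(s in `]a, b[) (g s * p s)].

Definition weakly_derivable a b u : Prop := exists g, is_weak_deriv a b u g.

(* A representative of the weak derivative, which is unique up to equality
   almost everywhere on ]a, b[. *)
Definition weak_deriv a b u : R -> R :=
  xget (fun=> 0) [set g | is_weak_deriv a b u g].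

Definition L2 a b u : Prop :=
  measurable_fun `]a, b[ u /\
  mu.-integrable `]a, b[ (fun s => (u s ^+ 2)%:E).

End Interval.

(** * Oriented finite graphs drawn in the plane *)

Record planar_graph (R : realType) := PlanarGraph {
  vertex : finType ;
  edge : finType ;
  pos : vertex -> 'cV[R]_2 ;
  src : edge -> vertex ;
  tgt : edge -> vertex ;
  lo : edge -> R ;
  hi : edge -> R ;
  curve : edge -> R -> 'cV[R]_2 }.

Section Graph.
Variables (R : realType) (G : planar_graph R).
Implicit Types (e : edge G) (u : 'cV[R]_2 -> R) (y z : 'cV[R]_2).
Let mu := @lebesgue_measure R.

Definition edge_dom e : set R := `]lo e, hi e[.

Definition edge_set e : set 'cV[R]_2 := curve e @` edge_dom e.

Definition Gamma : set 'cV[R]_2 :=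
  range (@pos R G) `|` \bigcup_e edge_set e.

Definition edge_rel : rel (vertex G) := [rel v w | [exists e : edge G,
  ((src e == v) && (tgt e == w)) || ((src e == w) && (tgt e == v))]].

Definition velocity e (s : R) : 'cV[R]_2 :=
  \col_i weak_deriv (lo e) (hi e) (fun r => curve e r i 0) s.

(* [curve e] restricted to [edge_dom e] is the arc length parametrization; its
   values at [lo e] and [hi e] are its continuous extension to the end points.
   A bounded curve whose weak derivative has Euclidean norm 1 a.e. is in
   W^{1,oo}. An edge may be a loop. *)
Record edge_wf e : Prop := {
  lo_lt_hi : lo e < hi e ;
  curve_continuous : {within `[lo e, hi e], continuous (curve e)} ;
  curve_src : curve e (lo e) = pos (src e) ;
  curve_tgt : curve e (hi e) = pos (tgt e) ;
  curve_inj : {in `]lo e, hi e[ &, injective (curve e)} ;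
  curve_derivable : forall i : 'I_2,
    weakly_derivable (lo e) (hi e) (fun s => curve e s i 0) ;
  curve_unit_speed : {ae mu, forall s, edge_dom e s ->
    \sum_i velocity e s i 0 ^+ 2 = 1} }.

(* The last three fields say that [Gamma] is the disjoint union of the
   vertices and of the open edges, so that a point of an edge determines the
   edge and its parameter. *)
Record graph_wf : Prop := {
  graph_edges : forall e, edge_wf e ;
  graph_connected : forall v w : vertex G, connect edge_rel v w ;
  pos_inj : injective (@pos R G) ;
  edges_disjoint : trivIset setT edge_set ;
  vertices_off_edges : forall (v : vertex G) e, ~ edge_set e (pos v) }.

(** * Calculus on a graph *)

(* The function on the edges equal to F e (s) at the point curve e s. *)
Definition on_edges (T : zmodType) (F : edge G -> R -> T) y : T :=
  xget 0 [set z | exists e s, [/\ edge_dom e s, curve e s = y & F e s = z]].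

Definition tangent : 'cV[R]_2 -> 'cV[R]_2 := on_edges velocity.

Definition dGamma u : 'cV[R]_2 -> R :=
  on_edges (fun e => weak_deriv (lo e) (hi e) (u \o curve e)).

Definition dGammav (phi : 'cV[R]_2 -> 'cV[R]_2) y : 'cV[R]_2 :=
  \col_i dGamma (fun z => phi z i 0) y.

(* Curve integral of the first kind; the speed of the curves is 1. *)
Definition intGamma u : R :=
  \sum_(e : edge G) \int[mu]_(s in edge_dom e) u (curve e s).

Definition intGamma_mx m n (F : 'cV[R]_2 -> 'M[R]_(m, n)) : 'M[R]_(m, n) :=
  \matrix_(i, j) intGamma (fun y => F y i j).

Definition total_length : R := intGamma (fun=> 1).

Definition L2_graph u : Prop :=
  forall e, L2 (lo e) (hi e) (u \o curve e).

Definition H1_graph u : Prop :=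
  [/\ L2_graph u,
      forall e, weakly_derivable (lo e) (hi e) (u \o curve e),
      L2_graph (dGamma u) &
      {within Gamma, continuous u}].

(** * Unit meshes and periodic functions *)

Definition unit_vec (i : 'I_2) : 'cV[R]_2 := delta_mx i 0.

Definition unit_square : set 'cV[R]_2 :=
  [set y | forall i, 0 <= y i 0 <= 1].

Definition corner y : Prop := forall i, y i 0 = 0 \/ y i 0 = 1.

(* When y and y + unit_vec i are both in the unit square, both are on its
   boundary. *)
Definition opposite y z : Prop :=
  [/\ Gamma y, Gamma z & exists i, z = y + unit_vec i].

Definition identified y z : Prop :=
  opposite y z \/ [/\ Gamma y, Gamma z, corner y & corner z].

Record unit_mesh : Prop := {
  mesh_graph : graph_wf ;
  mesh_square : Gamma `<=` unit_square ;
  mesh_crossing : forall i, exists y, Gamma y /\ Gamma (y + unit_vec i) ;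
  mesh_opposite : forall y z, opposite y z ->
    range (@pos R G) y /\ range (@pos R G) z }.

(* H^1 of the quotient of the graph by [identified]: a function on the
   quotient is continuous iff the function it induces on [Gamma] is. *)
Definition H1_graph_per u : Prop :=
  H1_graph u /\ forall y z, identified y z -> u y = u z.

(** * The cell problem and the homogenized matrix *)

Definition cell_solution (phi : 'cV[R]_2 -> 'cV[R]_2) : Prop :=
  (forall i, H1_graph_per (fun y => phi y i 0)) /\
  forall psi, H1_graph_per psi ->
    intGamma_mx (fun y => dGamma psi y *: dGammav phi y) =
    - intGamma_mx (fun y => dGamma psi y *: tangent y).

Definition A_hom (phi : 'cV[R]_2 -> 'cV[R]_2) : 'M[R]_2 :=
  total_length^-1 *: intGamma_mx (fun y =>
    (tangent y + dGammav phi y) *m (tangent y + dGammav phi y)^T).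

End Graph.

Definition symmetric_mx (R : realType) n (A : 'M[R]_n) : Prop := A^T = A.

Definition posdef_mx (R : realType) n (A : 'M[R]_n) : Prop :=
  forall x : 'cV[R]_n, x != 0 -> 0 < (x^T *m A *m x) 0 0.

(* Main.v *)
(* For a vector x, the quadratic form x^T A x is |Gamma|^-1 times the integral
   of the square of x . (t + d phi), which is the derivative along the graph of
   w(y) = x . (y + phi y). If it vanishes, then w has zero weak derivative on
   every edge, hence is constant on every closed edge by the du Bois-Reymond
   lemma, hence is constant on the vertices by connectedness. As phi is
   periodic, w (y + e_i) - w y = x_i, so crossing the cell gives x = 0. *)
Require Import Defs.
From mathcomp Require Import all_boot all_order all_algebra.
From mathcomp Require Import all_classical all_reals all_analysis.
From mathcomp Require Import measurable_realfun ring lra.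
Set Implicit Arguments.
Unset Strict Implicit.
Unset Printing Implicit Defensive.
Import Order.TTheory GRing.Theory Num.Theory.
Import numFieldNormedType.Exports.
Local Open Scope classical_set_scope.
Local Open Scope ring_scope.

Lemma quadratic_formE (R : comPzRingType) n (A : 'M[R]_n) (x : 'cV[R]_n) :
  (x^T *m A *m x) 0 0 = \sum_i \sum_j x i 0 * x j 0 * A i j.
Proof.
rewrite mxE exchange_big/=; apply: eq_bigr => j _.
rewrite mxE big_distrl/=; apply: eq_bigr => i _.
by rewrite mxE mulrAC.
Qed.

Section RintegralTheory.
Context d (T : measurableType d) (R : realType).
Variables (mu : {measure set T -> \bar R}) (D : set T).
Hypothesis mD : measurable D.
Implicit Types f : T -> R.

Lemma Rintegral_eq0_ae f : mu.-integrable D (EFin \o f) ->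
  (forall x, D x -> 0 <= f x) -> \int[mu]_(x in D) f x = 0 ->
  {ae mu, forall x, D x -> f x = 0}.
Proof.
move=> /[dup] f_int /integrableP[mf _] f0 If.
have : (\int[mu]_(x in D) `|(EFin \o f) x| = 0)%E.
  have -> : (\int[mu]_(x in D) `|(EFin \o f) x| = \int[mu]_(x in D) (f x)%:E)%E.
    by apply: eq_integral => x /set_mem Dx; rewrite /= ger0_norm// f0.
  rewrite -[LHS]fineK; last exact: integrable_fin_num.
  by rewrite -[fine _]/(Rintegral mu D f) If.
move/(ae_eq_integral_abs mu mD mf); apply: filterS => x /= + Dx.
by move=> /(_ Dx) [].
Qed.

Lemma integrableZl_EFin k f : mu.-integrable D (EFin \o f) ->
  mu.-integrable D (EFin \o (fun x => k * f x)).
Proof. exact: integrableZl. Qed.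

Section FiniteSums.
Context (I : Type) (F : I -> T -> R).
Hypothesis F_int : forall i, mu.-integrable D (EFin \o F i).

Lemma integrable_sum_EFin (r : seq I) :
  mu.-integrable D (EFin \o (fun x => \sum_(i <- r) F i x)).
Proof.
have := integrable_sum mD r (P := xpredT) (fun i _ => F_int i).
by apply: eq_integrable => // x _; rewrite /= sumEFin.
Qed.

Lemma Rintegral_sum (r : seq I) :
  \int[mu]_(x in D) (\sum_(i <- r) F i x) =
  \sum_(i <- r) \int[mu]_(x in D) F i x.
Proof.
elim: r => [|i r IH].
  under eq_Rintegral do rewrite big_nil.
  by rewrite big_nil Rintegral_cst// mul0r.
under eq_Rintegral do rewrite big_cons.
by rewrite big_cons -IH RintegralD//; exact: integrable_sum_EFin.
Qed.

End FiniteSums.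

Section SquaredSum.
Context (I : finType) (c : I -> R) (F : I -> T -> R).
Hypothesis FF_int : forall i j,
  mu.-integrable D (EFin \o (fun x => F i x * F j x)).

Let sqr_sumE x : (\sum_i c i * F i x) ^+ 2 =
  \sum_i \sum_j c i * c j * (F i x * F j x).
Proof.
rewrite expr2 big_distrlr/=.
by do 2 (apply: eq_bigr => ? _); rewrite mulrACA.
Qed.

Lemma integrable_sqr_sum :
  mu.-integrable D (EFin \o (fun x => (\sum_i c i * F i x) ^+ 2)).
Proof.
under [X in _ \o X]eq_fun do rewrite sqr_sumE.
have cFF_int i j := integrableZl_EFin (c i * c j) (FF_int i j).
by do 2 (apply: integrable_sum_EFin => ?); exact: cFF_int.
Qed.

Lemma Rintegral_sqr_sum :
  \int[mu]_(x in D) (\sum_i c i * F i x) ^+ 2 =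
  \sum_i \sum_j c i * c j * \int[mu]_(x in D) (F i x * F j x).
Proof.
under eq_Rintegral do rewrite sqr_sumE.
have cFF_int i j := integrableZl_EFin (c i * c j) (FF_int i j).
rewrite Rintegral_sum => [|i]; last exact: integrable_sum_EFin.
apply: eq_bigr => i _; rewrite Rintegral_sum//.
by apply: eq_bigr => j _; rewrite RintegralZl//; exact: FF_int.
Qed.

End SquaredSum.

End RintegralTheory.

Section LebesgueMeasure.
Variable R : realType.
Implicit Types (D : set R) (k : R) (u f : R -> R).
Local Notation mu := (@lebesgue_measure R).

Lemma open_negligible_set0 D : open D -> mu.-negligible D -> D = set0.
Proof.
move=> + [N [mN N0 DN]]; rewrite openE => oD; apply: contrapT => /eqP/set0P[x].
move=> /[dup] Dx /oD[r /= r0 xrD].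
have : (mu (ball x r) <= mu N)%E.
  apply: le_measure; rewrite ?inE//; first exact: measurable_ball.
  exact: subset_trans xrD DN.
by rewrite N0 (lebesgue_measure_ball _ (ltW r0)) lee_fin leNgt pmulrn_lgt0 ?r0.
Qed.

Lemma continuous_Rintegral_eq0 D f : open D -> {in D, continuous f} ->
  mu.-integrable D (EFin \o f) -> (forall x, D x -> 0 <= f x) ->
  \int[mu]_(x in D) f x = 0 -> forall x, D x -> f x = 0.
Proof.
move=> oD cf f_int f0 If x Dx; apply: contrapT => fx.
have mD := open_measurable oD.
suff : [set y | ~ (D y -> f y = 0)] = set0 by move/seteqP => [/(_ x)] /=; tauto.
apply: open_negligible_set0; last exact: Rintegral_eq0_ae.
have -> : [set y | ~ (D y -> f y = 0)] = D `&` f @^-1` [set z | z != 0].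
  by apply/predeqP => y; rewrite /= not_implyE; split=> -[Dy] /eqP.
rewrite openE => y [Dy fy]; apply: filterI; first exact: open_nbhs_nbhs.
by apply: (cf y (mem_set Dy)); apply: open_nbhs_nbhs; split => //;
  exact: open_neq.
Qed.

Lemma locally_integrableZ D k u :
  locally_integrable D u -> locally_integrable D (fun x => k * u x).
Proof.
move=> [mf oD u_int]; split => // [|K KD cK].
  by apply: measurable_funM => //; exact: measurable_cst.
have mK := compact_measurable cK.
suff : mu.-integrable K (EFin \o (fun x => k * u x)) by case/integrableP.
apply: integrableZl_EFin => //; apply/integrableP; split; last exact: u_int.
by apply/measurable_EFinP; apply: measurable_funS mf => //;
  exact: open_measurable.
Qed.

Lemma locally_integrable_cst D k : open D -> locally_integrable D (cst k).
Proof.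
move=> oD; have := locally_integrable_indic oD (@measurableT _ R).
move/(locally_integrableZ k); congr locally_integrable.
by apply/funext => x; rewrite indicT mulr1.
Qed.

End LebesgueMeasure.

Section CompactSupport.
Variable R : realType.
Implicit Types (a b c d x : R) (u h p q : R -> R).
Local Notation mu := (@lebesgue_measure R).

Lemma subset_itvcc_oo a b c d :
  a < c -> d < b -> {subset `[c, d] <= `]a, b[}.
Proof. by move=> ac db; apply: subitvP; rewrite subitvE !bnd_simp ac db. Qed.

Definition Cc a b h : Prop := continuous h /\
  exists c d, [/\ a < c, d < b & forall x, x \notin `[c, d] -> h x = 0].

Lemma near_eq0_off_segment c d h x :
  (forall y, y \notin `[c, d] -> h y = 0) -> x \notin `[c, d] ->
  \forall y \near x, h y = 0.
Proof.
move=> h0 xcd; have : open (~` `[c, d]).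
  by apply: closed_openC; exact: itv_closed.
rewrite openE => /(_ x (negP xcd)); apply: filterS => y /negP; exact: h0.
Qed.

Lemma Cc_mull a b u h : {in `]a, b[, continuous u} -> Cc a b h ->
  Cc a b (fun x => u x * h x).
Proof.
move=> cu [ch [c [d [ac db h0]]]]; split=> [x|]; last first.
  by exists c, d; split=> // x /h0 ->; rewrite mulr0.
have [xcd|xcd] := boolP (x \in `[c, d]).
  by apply: continuousM (ch x); apply: cu; exact: subset_itvcc_oo xcd.
rewrite /continuous_at h0// mulr0; apply: cvg_near_cst.
by apply: filterS (near_eq0_off_segment h0 xcd) => y ->; rewrite mulr0.
Qed.

Lemma restrict_Cc a b h : Cc a b h -> h \_ `]a, b[ = h.
Proof.
move=> [_ [c [d [ac db h0]]]]; apply/funext => x; rewrite patchE.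
case: ifPn => // xab; rewrite h0//; apply: contra xab => xcd.
by rewrite inE; exact: subset_itvcc_oo xcd.
Qed.

Lemma integrableM_Cc a b u h : locally_integrable `]a, b[ u -> Cc a b h ->
  mu.-integrable `]a, b[ (EFin \o (fun x => u x * h x)).
Proof.
move=> [u_meas _ u_int] [ch [c [d [ac db h0]]]].
have cd_sub : `[c, d] `<=` `]a, b[ by exact: subset_itvcc_oo.
have cd_int : mu.-integrable `[c, d] (EFin \o u).
  apply/integrableP; split; last first.
    exact: (u_int _ cd_sub (@segment_compact _ c d)).
  by apply/measurable_EFinP; apply: measurable_funS u_meas.
have -> : EFin \o (fun x => u x * h x) =
    ((EFin \o u) \* (EFin \o h))%E \_ `[c, d].
  apply/funext => x; rewrite patchE; case: ifPn => // xcd.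
  by rewrite /= h0 ?mulr0//; apply: contra xcd => xcd; rewrite inE.
apply/integrable_restrict => //; rewrite setIidr//; apply: integrableMl => //.
  by apply: measurable_funTS; exact: continuous_measurable_fun.
have /compact_bounded[M [_ hM]] : compact (h @` `[c, d]).
  by apply: continuous_compact (@segment_compact _ c d);
    exact: continuous_subspaceT.
exists M; split; rewrite ?num_real// => x xM y ycd.
by apply: (hM _ xM); exists y.
Qed.

Lemma integrable_Cc a b h : Cc a b h -> mu.-integrable `]a, b[ (EFin \o h).
Proof.
move=> hC; have oab : open `]a, b[%classic by exact: interval_open.
suff -> : h = (fun x => cst 1 x * h x).
  by apply: integrableM_Cc => //; exact: locally_integrable_cst.
by apply/funext => x; rewrite /= mul1r.
Qed.

Lemma test_function_Cc a b p : test_function a b p -> Cc a b p.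
Proof.
move=> [dp _ supp]; split=> // x.
exact/differentiable_continuous/derivable1_diffP.
Qed.

Lemma derive_test_function_Cc a b p : test_function a b p -> Cc a b (derive1 p).
Proof.
move=> [_ cdp [c [d [ac db p0]]]]; split=> //; exists c, d; split=> // x xcd.
rewrite derive1E (@near_eq_derive _ _ _ p (cst 0)) ?derive_cst//.
exact: near_eq0_off_segment p0 xcd.
Qed.

Lemma test_function_primitive a b q : Cc a b q ->
  \int[mu]_(x in `]a, b[) q x = 0 ->
  exists2 p, test_function a b p & derive1 p = q.
Proof.
move=> qC; rewrite Rintegral_mkcond restrict_Cc// => q_mean0.
have q_int : mu.-integrable setT (EFin \o q).
  rewrite -(restrict_Cc qC) -restrict_EFin.
  by apply: (integrable_mkcond _ _).1;
    [exact: measurable_itv|exact: integrable_Cc].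
case: qC => cq [c [d [ac db q0]]].
pose p x := \int[mu]_(t in `]-oo, x]) q t.
have FTC x : derivable p x 1 /\ derive1 p x = q x.
  apply: (continuous_FTC1 (a := -oo%O) (u := x + 1) _ _ _ (cq x)).
  - by rewrite ltrDl.
  - exact: integrableS q_int.
  - by rewrite ltNyr.
have dpE : derive1 p = q by apply/funext => x; have [] := FTC x.
exists p => //; split=> [x||]; [by have [] := FTC x|by rewrite dpE|].
exists c, d; split=> // x; rewrite in_itv/= negb_and -!ltNge => /orP[xc|dx].
  rewrite /p (eq_Rintegral _ (g := cst 0)) ?Rintegral_cst ?mul0r// => t.
  rewrite inE/= in_itv/= => tx; apply: q0.
  by rewrite in_itv/= negb_and -ltNge (le_lt_trans tx).
rewrite /p Rintegral_mkcond -[RHS]q_mean0; apply: eq_Rintegral => t _.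
rewrite patchE; case: ifPn => //; rewrite notin_setE/= in_itv/= => /negP.
rewrite -ltNge => xt; rewrite q0// in_itv/= negb_and -!ltNge.
by rewrite (lt_trans dx) ?orbT.
Qed.

Definition bump c d x : R := Num.max 0 ((x - c) * (d - x)).

Lemma bump_ge0 c d x : 0 <= bump c d x.
Proof. by rewrite le_max lexx. Qed.

Lemma bump_gt0 c d x : c < x < d -> 0 < bump c d x.
Proof. by case/andP=> cx xd; rewrite lt_max mulr_gt0 ?orbT ?subr_gt0. Qed.

Lemma bump_Cc a b c d : a < c -> c < d -> d < b -> Cc a b (bump c d).
Proof.
move=> ac cd db; split=> [x|].
  have parabola_cts : {for x, continuous (fun x => (x - c) * (d - x))}.
    by apply: continuousM; apply: continuousB => //; exact: cst_continuous.
  exact: (continuous_max (@cst_continuous _ _ 0 x) parabola_cts).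
exists c, d; split=> // x; rewrite in_itv/= negb_and -!ltNge => xcd.
by apply/max_idPl; case/orP: xcd => ?; nra.
Qed.

Lemma Rintegral_bump_neq0 a b c d : a < c -> c < d -> d < b ->
  \int[mu]_(x in `]a, b[) bump c d x != 0.
Proof.
move=> ac cd db; have bumpC := bump_Cc ac cd db.
pose m := (c + d) / 2.
have mcd : c < m < d by rewrite /m; apply/andP; split; lra.
apply/eqP => bump_int0; have := bump_gt0 mcd.
rewrite (continuous_Rintegral_eq0 _ _ _ _ bump_int0) ?ltxx//.
- by move=> x _; exact: bumpC.1.
- exact: integrable_Cc.
- by move=> x _; exact: bump_ge0.
- by case/andP: mcd => cm md; rewrite /= in_itv/= (lt_trans ac) ?(lt_trans md).
Qed.

End CompactSupport.

Section WeakDerivative.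
Variable R : realType.
Implicit Types (a b k : R) (u v g h p : R -> R).
Local Notation mu := (@lebesgue_measure R).

Lemma weak_derivP a b u :
  weakly_derivable a b u -> is_weak_deriv a b u (weak_deriv a b u).
Proof. by case=> g ug; apply: (xgetPex (fun=> 0)); exists g. Qed.

Lemma is_weak_deriv0 a b : is_weak_deriv a b (cst 0) (cst 0).
Proof.
split=> [||p _]; [exact/locally_integrable_cst/interval_open..|].
under eq_Rintegral do rewrite mul0r.
under [in RHS]eq_Rintegral do rewrite mul0r.
by rewrite Rintegral_cst// mul0r oppr0.
Qed.

Lemma is_weak_derivD a b u v g h :
  is_weak_deriv a b u g -> is_weak_deriv a b v h ->
  is_weak_deriv a b (u \+ v) (g \+ h).
Proof.
move=> [u_int g_int ug] [v_int h_int vh].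
split=> [||p tp]; [exact: locally_integrableD..|].
have pC := test_function_Cc tp.
have dpC := derive_test_function_Cc tp.
under eq_Rintegral do rewrite /= mulrDl.
under [in RHS]eq_Rintegral do rewrite /= mulrDl.
by rewrite !RintegralD ?ug ?vh ?opprD//; exact: integrableM_Cc.
Qed.

Lemma is_weak_derivZ a b k u g : is_weak_deriv a b u g ->
  is_weak_deriv a b (fun x => k * u x) (fun x => k * g x).
Proof.
move=> [u_int g_int ug].
split=> [||p tp]; [exact: locally_integrableZ..|].
have pC := test_function_Cc tp.
have dpC := derive_test_function_Cc tp.
under eq_Rintegral do rewrite -mulrA.
under [in RHS]eq_Rintegral do rewrite -mulrA.
by rewrite !RintegralZl ?ug ?mulrN//; exact: integrableM_Cc.
Qed.

Lemma is_weak_deriv_sum (I : Type) (r : seq I) a b (u g : I -> R -> R) :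
  (forall i, is_weak_deriv a b (u i) (g i)) ->
  is_weak_deriv a b (\sum_(i <- r) u i) (\sum_(i <- r) g i).
Proof.
move=> ug; elim/big_rec2: _ => [|i v h _]; first exact: is_weak_deriv0.
exact: is_weak_derivD.
Qed.

End WeakDerivative.

Section DuBoisReymond.
Variables (R : realType) (a b : R) (u g : R -> R).
Local Notation mu := (@lebesgue_measure R).
Hypothesis ug : is_weak_deriv a b u g.
Hypothesis g0 : {ae mu, forall x, `]a, b[%classic x -> g x = 0}.

Lemma weak_deriv0_orthogonal q : Cc a b q ->
  \int[mu]_(x in `]a, b[) q x = 0 -> \int[mu]_(x in `]a, b[) (u x * q x) = 0.
Proof.
case: ug => _ g_int u_parts qC /(test_function_primitive qC)[p tp <-].
rewrite u_parts//; apply/eqP; rewrite oppr_eq0; apply/eqP.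
rewrite /Rintegral (@ae_eq_integral _ _ _ _ _ (cst 0%E))// ?integral0//.
  by have /integrableP[] := integrableM_Cc g_int (test_function_Cc tp).
apply: (@filterS _ _ (ae_filter_ringOfSetsType mu)) g0 => x gx /gx.
by rewrite /= => ->; rewrite mul0r.
Qed.

(* With k the mean of u against the weight bump c d, the function
   (u - k) * bump c d has mean zero, hence is orthogonal to u and to k, so the
   variance \int (u - k) ^+ 2 * bump c d vanishes. *)
Lemma weak_deriv0_cst_subitv c d : {in `]a, b[, continuous u} ->
  a < c -> c < d -> d < b -> exists k, {in `]c, d[, u =1 cst k}.
Proof.
move=> cu ac cd db; have bumpC := bump_Cc ac cd db.
pose k := \int[mu]_(x in `]a, b[) (u x * bump c d x) /
  \int[mu]_(x in `]a, b[) bump c d x.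
pose q x := (u x - k) * bump c d x.
have cuk : {in `]a, b[, continuous (fun x => u x - k)}.
  by move=> x /cu cux; apply: (continuousB cux); exact: cst_continuous.
have qC : Cc a b q by exact: Cc_mull.
have q_mean0 : \int[mu]_(x in `]a, b[) q x = 0.
  have bump_int := integrable_Cc bumpC.
  under eq_Rintegral do rewrite /q mulrBl.
  rewrite RintegralB ?RintegralZl ?divfK ?subrr//.
  - exact: Rintegral_bump_neq0.
  - exact/integrable_Cc/Cc_mull.
  - exact: integrableZl_EFin.
have variance0 : \int[mu]_(x in `]a, b[) ((u x - k) * q x) = 0.
  have q_int := integrable_Cc qC.
  under eq_Rintegral do rewrite mulrBl.
  rewrite RintegralB ?RintegralZl//.
  - by rewrite weak_deriv0_orthogonal// q_mean0 mulr0 subrr.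
  - exact/integrable_Cc/Cc_mull.
  - exact: integrableZl_EFin.
exists k => x; rewrite in_itv/= => xcd.
have : (u x - k) * q x = 0.
  apply: (continuous_Rintegral_eq0 _ _ _ _ variance0).
  - exact: interval_open.
  - by move=> y _; exact: (Cc_mull cuk qC).1.
  - exact/integrable_Cc/Cc_mull.
  - by move=> y _; rewrite /q mulrA -expr2 mulr_ge0 ?sqr_ge0 ?bump_ge0.
  - case/andP: xcd => cx xd.
    by rewrite /= in_itv/= (lt_trans ac) ?(lt_trans xd).
move/eqP; rewrite /q mulrA !mulf_eq0 orbb (gt_eqF (bump_gt0 xcd)) orbF.
by rewrite subr_eq0 => /eqP.
Qed.

Lemma weak_deriv0_cst_itvoo : {in `]a, b[, continuous u} ->
  {in `]a, b[ &, forall s t, u s = u t}.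
Proof.
move=> cu s t; wlog st : s t / s <= t.
  move=> cst_le ? ?; case: (leP s t) => [|/ltW] ts; [|apply/esym];
    exact: cst_le.
rewrite !in_itv/= => /andP[a_s _] /andP[_ t_b].
have [||| k uk] := @weak_deriv0_cst_subitv ((a + s) / 2) ((t + b) / 2) cu.
1-3: lra.
by rewrite !uk// in_itv/=; apply/andP; split; lra.
Qed.

Lemma weak_deriv0_cst_itvcc : a < b -> {within `[a, b], continuous u} ->
  {in `[a, b] &, forall s t, u s = u t}.
Proof.
move=> ab /(continuous_within_itvP _ ab)[cu cua cub].
pose z := (a + b) / 2.
have zab : z \in `]a, b[ by rewrite in_itv/= /z; apply/andP; split; lra.
have u_inside x : a < x -> x < b -> u x = u z.
  by move=> ax xb; apply: (weak_deriv0_cst_itvoo cu); rewrite // in_itv/= ax.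
suff u_cst x : x \in `[a, b] -> u x = u z by move=> s t /u_cst-> /u_cst->.
rewrite in_itv/= => /andP[ax xb].
have [->|x_neq_a] := eqVneq x a; last have [->|x_neq_b] := eqVneq x b.
- apply: (cvg_unique _ cua); first exact: norm_hausdorff.
  by apply: cvg_near_cst; near=> y; apply: u_inside; near: y;
    [exact: nbhs_right_gt|exact: nbhs_right_lt].
- apply: (cvg_unique _ cub); first exact: norm_hausdorff.
  by apply: cvg_near_cst; near=> y; apply: u_inside; near: y;
    [exact: nbhs_left_gt|exact: nbhs_left_lt].
- by apply: u_inside; rewrite lt_neqAle ?x_neq_b// eq_sym x_neq_a.
Unshelve. all: by end_near. Qed.

End DuBoisReymond.

Section SquareIntegrable.
Variable R : realType.
Implicit Types (a b M : R) (f g : R -> R).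
Local Notation mu := (@lebesgue_measure R).

Lemma L2_integrableM a b f g : L2 a b f -> L2 a b g ->
  mu.-integrable `]a, b[ (EFin \o (fun x => f x * g x)).
Proof.
move=> [mf f2_int] [mg g2_int].
apply: le_integrable (integrableD _ f2_int g2_int) => //.
  by apply/measurable_EFinP; exact: measurable_funM.
move=> x _; rewrite /= lee_fin [leRHS]ger0_norm ?addr_ge0 ?sqr_ge0//.
by rewrite ler_norml; apply/andP; split; nra.
Qed.

Lemma L2D a b f g : L2 a b f -> L2 a b g -> L2 a b (f \+ g).
Proof.
move=> fL2 gL2; have fg_int := L2_integrableM fL2 gL2.
case: fL2 gL2 => [mf f2_int] [mg g2_int]; split; first exact: measurable_funD.
have -> : (fun x => ((f \+ g) x ^+ 2)%:E) = ((fun x => (f x ^+ 2)%:E) \+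
    ((EFin \o (fun x => f x * g x)%R) \+ (EFin \o (fun x => f x * g x)%R)) \+
    (fun x => (g x ^+ 2)%:E))%E.
  by apply/funext => x; rewrite /= -!EFinD; congr EFin; ring.
by do 3 (apply: integrableD => //).
Qed.

Lemma eq_L2 a b f g : {in `]a, b[, f =1 g} -> L2 a b f -> L2 a b g.
Proof.
move=> fg [mf f2_int]; split.
  by apply: eq_measurable_fun mf => x; rewrite inE => /fg.
by apply: eq_integrable f2_int => // x; rewrite inE => /fg /= ->.
Qed.

Lemma L2_ae_bounded a b M f : measurable_fun `]a, b[ f ->
  {ae mu, forall s, `]a, b[%classic s -> f s ^+ 2 <= M} -> L2 a b f.
Proof.
move=> mf fM; split => //; apply/integrableP.
have mf2 : measurable_fun `]a, b[ (fun s => (f s ^+ 2)%:E).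
  by apply/measurable_EFinP; exact: measurable_funX.
split => //; apply: (@le_lt_trans _ _ (\int[mu]_(x in `]a, b[) `|M|%:E)%E).
  apply: ae_ge0_le_integral => //; first exact: measurableT_comp.
  apply: (@filterS _ _ (ae_filter_ringOfSetsType mu)) fM => x fx /fx.
  by rewrite /= ger0_norm ?sqr_ge0// lee_fin => /le_trans->//; exact: ler_norm.
rewrite integral_cst//= lebesgue_measure_itv/=.
by case: ifPn => _; rewrite ?mule0 ?ltry// -EFinB -EFinM ltry.
Qed.

End SquareIntegrable.

Section Graph.
Variables (R : realType) (G : planar_graph R).
Implicit Types (e : edge G) (v w : vertex G) (u : 'cV[R]_2 -> R).
Local Notation mu := (@lebesgue_measure R).

Lemma pos_Gamma v : Gamma G (pos v).
Proof. by left; exists v. Qed.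

Lemma eq_connected (T : Type) (f : vertex G -> T) v w :
  (forall e, f (src e) = f (tgt e)) -> connect (@edge_rel R G) v w -> f v = f w.
Proof.
move=> fe /connectP[p]; elim: p v => [|z p IH] v /=; first by move=> _ ->.
move=> /andP[/existsP[e /orP[]/andP[/eqP<- /eqP<-]] pz] wz;
  by rewrite -(IH _ pz wz) fe.
Qed.

Lemma measurable_edge_dom e : measurable (edge_dom e).
Proof. exact: measurable_itv. Qed.

Lemma trmx_intGamma m n (F : 'cV[R]_2 -> 'M[R]_(m, n)) :
  (intGamma_mx G F)^T = intGamma_mx G (fun y => (F y)^T).
Proof.
apply/matrixP => i j; rewrite !mxE; apply: eq_bigr => e _.
by apply: eq_Rintegral => s _; rewrite mxE.
Qed.

Hypothesis wf : graph_wf G.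

Lemma on_edgesE (T : zmodType) (F : edge G -> R -> T) e s :
  edge_dom e s -> on_edges F (curve e s) = F e s.
Proof.
move=> es; rewrite /on_edges; set Z := [set z | _].
have [e' [s' [es' cs <-]]] : Z (xget 0 Z).
  by apply: xgetPex; exists (F e s), e, s.
have ee' : e' = e.
  by apply: (edges_disjoint wf) => //; exists (curve e s);
    split; [exists s'|exists s].
move: es' cs; rewrite ee' => es' cs.
by rewrite (curve_inj (graph_edges wf e) _ _ cs).
Qed.

Lemma curve_Gamma e s : s \in `[lo e, hi e] -> Gamma G (curve e s).
Proof.
have we := graph_edges wf e.
have [->|s_neq_lo] := eqVneq s (lo e).
  by rewrite (curve_src we) => _; exact: pos_Gamma.
have [->|s_neq_hi] := eqVneq s (hi e).
  by rewrite (curve_tgt we) => _; exact: pos_Gamma.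
rewrite in_itv/= => /andP[lo_s s_hi]; right; exists e => //; exists s => //.
by rewrite /edge_dom /= in_itv/= !lt_neqAle eq_sym s_neq_lo s_neq_hi lo_s.
Qed.

Lemma within_continuous_curve u e : {within Gamma G, continuous u} ->
  {within `[lo e, hi e], continuous (u \o curve e)}.
Proof.
move=> /subspace_continuousP cu; apply/subspace_continuousP => s es.
have /subspace_continuousP/(_ s es) cc := curve_continuous (graph_edges wf e).
move=> W /= /(cu _ (curve_Gamma es))/= /cc; rewrite /within /nbhs/=.
by apply: filterS => t /= Wt et; apply: (Wt et); exact: curve_Gamma.
Qed.

Lemma velocityE e i :
  (fun s => velocity e s i 0) =
  weak_deriv (lo e) (hi e) (fun r => curve e r i 0).
Proof. by apply/funext => s; rewrite mxE. Qed.

Lemma velocity_L2 e i : L2 (lo e) (hi e) (fun s => velocity e s i 0).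
Proof.
have we := graph_edges wf e; apply: (@L2_ae_bounded _ _ _ 1).
  by rewrite velocityE; have [_ []] := weak_derivP (curve_derivable we i).
have := curve_unit_speed we.
apply: (@filterS _ _ (ae_filter_ringOfSetsType mu)) => s + es => /(_ es) <-.
by rewrite (bigD1 i)//= lerDl sumr_ge0// => j _; exact: sqr_ge0.
Qed.

Lemma weak_deriv_curve_L2 u e : H1_graph G u ->
  L2 (lo e) (hi e) (weak_deriv (lo e) (hi e) (u \o curve e)).
Proof.
by move=> [_ _ /(_ e) + _]; apply: eq_L2 => s es; rewrite /= /dGamma on_edgesE.
Qed.

Lemma total_lengthE : total_length G = \sum_(e : edge G) (hi e - lo e).
Proof.
apply: eq_bigr => e _.
rewrite Rintegral_cst ?mul1r; last exact: measurable_edge_dom.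
by rewrite /= lebesgue_measure_itv/= lte_fin (lo_lt_hi (graph_edges wf e)).
Qed.

Lemma total_length_gt0 : (0 < #|edge G|)%N -> 0 < total_length G.
Proof.
case/card_gt0P=> e0 _; rewrite total_lengthE (bigD1 e0)//=.
apply: ltr_pwDl; first by rewrite subr_gt0 (lo_lt_hi (graph_edges wf e0)).
by apply: sumr_ge0 => e _; rewrite subr_ge0 ltW// (lo_lt_hi (graph_edges wf e)).
Qed.

End Graph.

Section UnitMesh.
Variables (R : realType) (G : planar_graph R).
Hypothesis mesh : unit_mesh G.

Lemma unit_mesh_crossing_vertices i :
  exists v w : vertex G, pos w = pos v + unit_vec R i.
Proof.
have [y [Gy Gyi]] := mesh_crossing mesh i.
have yyi : opposite G y (y + unit_vec R i) by split => //; exists i.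
have [[v _ vy] [w _ wy]] := mesh_opposite mesh yyi.
by exists v, w; rewrite vy wy.
Qed.

Lemma unit_mesh_card_edge_gt0 : (0 < #|edge G|)%N.
Proof.
rewrite lt0n; apply/negP => /eqP/card0_eq no_edge.
have [v [w vw]] := unit_mesh_crossing_vertices 0.
have /eqP : pos v = pos w.
  apply: eq_connected => [e|]; first by have := no_edge e; rewrite !inE.
  exact: graph_connected (mesh_graph mesh) v w.
rewrite vw eq_sym -subr_eq0 addrAC subrr add0r => /eqP/matrixP/(_ 0 0)/eqP.
by rewrite !mxE !eqxx oner_eq0.
Qed.

End UnitMesh.

Section Energy.
Variables (R : realType) (G : planar_graph R) (phi : 'cV[R]_2 -> 'cV[R]_2).
Implicit Types (e : edge G) (x y : 'cV[R]_2).
Local Notation mu := (@lebesgue_measure R).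

Definition corrected_tangent e (i : 'I_2) (s : R) : R := velocity e s i 0 +
  weak_deriv (lo e) (hi e) ((fun y => phi y i 0) \o curve e) s.

Definition potential x y : R := \sum_i x i 0 * (y i 0 + phi y i 0).

Definition energy x e : R :=
  \int[mu]_(s in edge_dom e) (\sum_i x i 0 * corrected_tangent e i s) ^+ 2.

Lemma energy_ge0 x e : 0 <= energy x e.
Proof. by apply: Rintegral_ge0 => s _; exact: sqr_ge0. Qed.

Lemma potential_unit_vec x y i : phi (y + unit_vec R i) = phi y ->
  potential x (y + unit_vec R i) - potential x y = x i 0.
Proof.
move=> phi_per; rewrite /potential -sumrB (bigD1 i)//= big1 => [|k ki].
  by rewrite phi_per !mxE !eqxx/=; ring.
by rewrite phi_per !mxE (negPf ki)/=; ring.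
Qed.

Lemma trmx_A_hom : (A_hom G phi)^T = A_hom G phi.
Proof.
rewrite /A_hom linearZ/= trmx_intGamma; congr (_ *: intGamma_mx G _).
by apply/funext => y; rewrite trmx_mul trmxK.
Qed.

Hypothesis wf : graph_wf G.

Lemma A_homE i j : A_hom G phi i j = (total_length G)^-1 *
  \sum_e \int[mu]_(s in edge_dom e)
    (corrected_tangent e i s * corrected_tangent e j s).
Proof.
rewrite !mxE; congr (_ * _); apply: eq_bigr => e _.
apply: eq_Rintegral => s; rewrite inE => es.
by rewrite !mxE big_ord1 !mxE /tangent /dGamma !on_edgesE.
Qed.

Hypothesis phi_H1 : forall i, H1_graph G (fun y => phi y i 0).

Lemma corrected_tangent_L2 e i : L2 (lo e) (hi e) (corrected_tangent e i).
Proof. by apply: L2D; [exact: velocity_L2|exact: weak_deriv_curve_L2]. Qed.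

Lemma corrected_tangent_int e i j : mu.-integrable (edge_dom e)
  (EFin \o (fun s => corrected_tangent e i s * corrected_tangent e j s)).
Proof. by apply: L2_integrableM; exact: corrected_tangent_L2. Qed.

Lemma A_hom_quadratic_form x : (x^T *m A_hom G phi *m x) 0 0 =
  (total_length G)^-1 * \sum_e energy x e.
Proof.
have energyE e : energy x e = \sum_i \sum_j x i 0 * x j 0 *
    \int[mu]_(s in edge_dom e)
      (corrected_tangent e i s * corrected_tangent e j s).
  by apply: Rintegral_sqr_sum => *;
    [exact: measurable_edge_dom|exact: corrected_tangent_int].
rewrite quadratic_formE (eq_bigr _ (fun e _ => energyE e)).
rewrite [in RHS]exchange_big big_distrr; apply: eq_bigr => i _ /=.
rewrite [in RHS]exchange_big big_distrr; apply: eq_bigr => j _ /=.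
by rewrite A_homE mulrCA big_distrr.
Qed.

Lemma potential_continuous x e :
  {within `[lo e, hi e], continuous (potential x \o curve e)}.
Proof.
apply: within_continuous_curve => //; apply/subspace_continuousP => y Gy.
apply: cvg_big => [|i _]; first exact: add_continuous.
apply: cvgM; first exact: cvg_cst.
apply: cvgD; first by apply: cvg_within_filter; exact: coord_continuous.
by have [_ _ _ /subspace_continuousP] := phi_H1 i; exact.
Qed.

Lemma potential_weak_deriv x e :
  is_weak_deriv (lo e) (hi e) (potential x \o curve e)
    (fun s => \sum_i x i 0 * corrected_tangent e i s).
Proof.
have -> : potential x \o curve e =
    \sum_i (fun s => x i 0 * (curve e s i 0 + phi (curve e s) i 0)).
  by apply/funext => s; rewrite fct_sumE.
have -> : (fun s => \sum_i x i 0 * corrected_tangent e i s) =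
    \sum_i (fun s => x i 0 * corrected_tangent e i s).
  by apply/funext => s; rewrite fct_sumE.
apply: is_weak_deriv_sum => i; apply/is_weak_derivZ/is_weak_derivD.
  by rewrite velocityE; exact/weak_derivP/curve_derivable/graph_edges.
by apply: weak_derivP; have [_ + _ _] := phi_H1 i; exact.
Qed.

Lemma potential_src_tgt x e : energy x e = 0 ->
  potential x (pos (src e)) = potential x (pos (tgt e)).
Proof.
move=> energy0; have we := graph_edges wf e; have lo_hi := lo_lt_hi we.
have slope0 : {ae mu, forall s, `]lo e, hi e[%classic s ->
    \sum_i x i 0 * corrected_tangent e i s = 0}.
  have : {ae mu, forall s, `]lo e, hi e[%classic s ->
      (\sum_i x i 0 * corrected_tangent e i s) ^+ 2 = 0}.
    apply: Rintegral_eq0_ae energy0 => [||s _]; last exact: sqr_ge0.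
      exact: measurable_edge_dom.
    by apply: integrable_sqr_sum => *;
      [exact: measurable_edge_dom|exact: corrected_tangent_int].
  apply: (@filterS _ _ (ae_filter_ringOfSetsType mu)) => s + es => /(_ es)/eqP.
  by rewrite sqrf_eq0 => /eqP.
rewrite -(curve_src we) -(curve_tgt we).
apply: (weak_deriv0_cst_itvcc (@potential_weak_deriv x e) slope0 lo_hi
  (@potential_continuous x e)); by rewrite in_itv/= lexx ltW.
Qed.

End Energy.

Lemma energy_eq0 (R : realType) (G : planar_graph R)
    (phi : 'cV[R]_2 -> 'cV[R]_2) (x : 'cV[R]_2) :
  unit_mesh G -> (forall i, H1_graph_per G (fun y => phi y i 0)) ->
  (forall e : edge G, energy phi x e = 0) -> x = 0.
Proof.
move=> mesh phi_per energy0; have wf := mesh_graph mesh.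
apply/matrixP => i j; rewrite ord1 mxE {j}.
have [v [w vw]] := unit_mesh_crossing_vertices mesh i.
have phi_vw : phi (pos v + unit_vec R i) = phi (pos v).
  apply/matrixP => k j; rewrite ord1 -vw; apply/esym/(phi_per k).2; left.
  by split; [exact: pos_Gamma..|exists i].
rewrite -(potential_unit_vec x phi_vw) -vw; apply/eqP; rewrite subr_eq0.
apply/eqP/(eq_connected (f := potential phi x \o @pos R G)) => [e|] /=.
  by apply: potential_src_tgt => // k; case: (phi_per k).
exact: graph_connected.
Qed.

Theorem lemma3p8 (R : realType) (G : planar_graph R)
  (phi : 'cV[R]_2 -> 'cV[R]_2) :
  unit_mesh G -> cell_solution G phi ->
  symmetric_mx (A_hom G phi) /\ posdef_mx (A_hom G phi).
Proof.
move=> mesh [phi_per _]; have wf := mesh_graph mesh.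
have phi_H1 i : H1_graph G (fun y => phi y i 0) by case: (phi_per i).
split; first exact: trmx_A_hom.
move=> x x_neq0; rewrite A_hom_quadratic_form// mulr_gt0//.
  by rewrite invr_gt0 total_length_gt0// unit_mesh_card_edge_gt0.
rewrite lt0r sumr_ge0 => [|e _]; last exact: energy_ge0.
rewrite andbT; apply: contra x_neq0.
rewrite psumr_eq0 => [/allP energy0|e _]; last exact: energy_ge0.
apply/eqP/(energy_eq0 mesh phi_per) => e.
exact/eqP/(implyP (energy0 e (mem_index_enum e))).
Qed.
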